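(* Let $\psi = \sum_{i=1}^{\infty} 1/F_i$. Then the reciprocal Fibonacci series converges exponentially: $$\psi - \sum_{i=1}^{n}\frac1{F_i} = O(\alpha^{-n}),$$ and the ratio of consecutive tails satisfies $$\frac{\psi - \sum_{i=1}^{n+1} 1/F_i}{\psi - \sum_{i=1}^{n} 1/F_i} \longrightarrow \frac1\alpha \qquad (n\to\infty)$$ (numerically $1/\alpha\approx 0.618$).
   Context: $F_n$ ($n\ge1$) are the Fibonacci numbers: $F_1=F_2=1$, $F_n=F_{n-1}+F_{n-2}$ for $n\ge3$. $\alpha = \frac{1+\sqrt5}{2}$ is the golden ratio. *)

(* Defs.v *)
From HB Require Import structures.
From mathcomp Require Import all_boot all_order all_algebra.
From mathcomp Require Import all_classical all_reals all_analysis.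

Set Implicit Arguments.
Unset Strict Implicit.
Unset Printing Implicit Defensive.

Import Order.TTheory GRing.Theory Num.Theory.
Import numFieldNormedType.Exports.

Local Open Scope ring_scope.
Local Open Scope classical_set_scope.

(* The extra value [fib 0 = 0] gives [fib 1 = fib 2 = 1] and is not used in
   the sums below, which start at index 1. *)
Fixpoint fib (n : nat) : nat :=
  if n is m.+1 then (if m is k.+1 then fib m + fib k else 1)%N else 0%N.

Definition golden_ratio (R : realType) : R := (1 + Num.sqrt 5) / 2.

Definition recip_fib_sum (R : realType) (n : nat) : R :=
  \sum_(1 <= i < n.+1) ((fib i)%:R)^-1.

(* [limn] returns a default value on divergent sequences, so convergence of the
   partial sums has to be asserted separately wherever it is meant. *)
Definition recip_fib_const (R : realType) : R := limn (recip_fib_sum R).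

(* Main.v *)
Require Import Defs.
From HB Require Import structures.
From mathcomp Require Import all_boot all_order all_algebra.
From mathcomp Require Import all_classical all_reals all_analysis.
From mathcomp Require Import ring lra.
Import Order.TTheory GRing.Theory Num.Theory.
Import numFieldNormedType.Exports.
Local Open Scope ring_scope.
Local Open Scope classical_set_scope.

(** Write [b] for the inverse of the golden ratio [phi], [S n] for the partial
    sums and [T n = psi - S n] for the tails.

    Since [phi ^+ n <= phi * F_(n+1)], the term [1 / F_(n+1)] is at most
    [phi * b ^+ n], which is exactly the decrease of [phi ^+ 3 * b ^+ n] from
    [n] to [n+1] because [1 - b = b ^+ 2].  Hence [S n + phi ^+ 3 * b ^+ n] is
    nonincreasing while [S n] is increasing: the two sequences squeeze the limit
    [psi], giving convergence and [0 < T n <= phi ^+ 3 * b ^+ n].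

    For the ratio, the terms themselves are nearly geometric.  The identity
    [b * F_(n+1) - F_n = b * (- b) ^+ n] bounds their
    deviation from an exact geometric progression:
    [`|1 / F_(i+1) - b / F_i| <= b ^+ i.-1 / F_i].  Summing over [i > n], where
    [b ^+ i.-1 <= b ^+ n], yields [`|T n.+1 - b * T n| <= b ^+ n * T n]; dividing by
    [T n > 0] shows that the ratio is within [b ^+ n] of [b]. *)

Section ReciprocalFibonacci.
Variable R : realType.

Local Notation phi := (golden_ratio R).
Local Notation b := (golden_ratio R)^-1.
Local Notation S := (recip_fib_sum R).
Local Notation psi := (recip_fib_const R).

Lemma golden_ratio_gt1 : 1 < phi.
Proof.
have s5 : 1 < Num.sqrt (5 : R) by rewrite -[ltLHS]sqrtr1 ltr_sqrt ?ltr1n.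
by rewrite /golden_ratio; lra.
Qed.

Lemma golden_ratio_gt0 : 0 < phi.
Proof. exact: lt_trans ltr01 golden_ratio_gt1. Qed.

Lemma golden_ratio_sqr : phi ^+ 2 = phi + 1.
Proof.
have s5 : Num.sqrt (5 : R) ^+ 2 = 5 by rewrite sqr_sqrtr ?ler0n.
rewrite /golden_ratio; nra.
Qed.

Lemma inv_golden_ratio_gt0 : 0 < b.
Proof. by rewrite invr_gt0 golden_ratio_gt0. Qed.

Lemma inv_golden_ratio_lt1 : b < 1.
Proof. by rewrite invf_lt1 ?golden_ratio_gt0 ?golden_ratio_gt1. Qed.

Lemma inv_golden_ratio_sqr : b ^+ 2 = 1 - b.
Proof.
have p0 : phi != 0 by rewrite gt_eqF ?golden_ratio_gt0.
apply: (mulfI (expf_neq0 2 p0)); rewrite -exprMn divff// expr1n mulrBr mulr1.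
by rewrite expr2 mulfK// -expr2 golden_ratio_sqr addrAC subrr add0r.
Qed.

Lemma fibSS n : fib n.+2 = (fib n.+1 + fib n)%N.
Proof. by []. Qed.

Lemma fibS_gt0 n : (0 < fib n.+1)%N.
Proof. by elim: n => // n IH; rewrite fibSS addn_gt0 IH. Qed.

Lemma exp_golden_ratio_le_fib n : phi ^+ n <= phi * (fib n.+1)%:R.
Proof.
(* The recurrence has order two, so the induction carries two bounds. *)
suff [] : phi ^+ n <= phi * (fib n.+1)%:R /\ phi ^+ n.+1 <= phi * (fib n.+2)%:R
  by [].
elim: n => [|n [IH0 IH1]].
  by rewrite expr0 expr1 /= addn0 mulr1 lexx (ltW golden_ratio_gt1).
have -> : phi ^+ n.+2 = phi ^+ n.+1 + phi ^+ n.
  by rewrite -addn2 exprD golden_ratio_sqr mulrDr mulr1 -exprSr.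
by split=> //; rewrite fibSS natrD mulrDr lerD.
Qed.

(** The termwise comparison with a geometric series that drives both
    convergence and the exponential bound on the tails. *)
Lemma inv_fib_le n : (fib n.+1)%:R^-1 <= phi * b ^+ n.
Proof.
have F0 : 0 < (fib n.+1)%:R :> R by rewrite ltr0n fibS_gt0.
rewrite exprVn ler_pdivlMr ?exprn_gt0 ?golden_ratio_gt0//.
by rewrite mulrC ler_pdivrMr// exp_golden_ratio_le_fib.
Qed.

(** The linear combination of consecutive Fibonacci numbers that removes the
    dominant root [phi] of the recurrence leaves only the conjugate root
    [- b]. *)
Lemma fib_defect n : b * (fib n.+1)%:R - (fib n)%:R = b * (- b) ^+ n.
Proof.
elim: n => [|n IH]; first by rewrite subr0.
rewrite fibSS natrD exprS mulrCA -IH.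
have b2 := inv_golden_ratio_sqr; ring: b2.
Qed.

(** [fib_defect] divided by the product of the two Fibonacci numbers.  The bound
    keeps one of the reciprocals as a factor: the sum of these bounds is then
    controlled by the tail itself, and not just by a power of [b]. *)
Lemma inv_fib_ratio n :
  `|(fib n.+2)%:R^-1 - b * (fib n.+1)%:R^-1| <= b ^+ n * (fib n.+1)%:R^-1.
Proof.
have F1 : 0 < (fib n.+1)%:R :> R by rewrite ltr0n fibS_gt0.
have F2 : 1 <= (fib n.+2)%:R :> R by rewrite ler1n fibS_gt0.
have F2' : 0 < (fib n.+2)%:R :> R := lt_le_trans ltr01 F2.
have b0 := inv_golden_ratio_gt0; have b1 := inv_golden_ratio_lt1.
have -> : (fib n.+2)%:R^-1 - b * (fib n.+1)%:R^-1
    = - (b * (fib n.+2)%:R - (fib n.+1)%:R)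
      * ((fib n.+2)%:R^-1 * (fib n.+1)%:R^-1).
  move: b (fib n.+1)%:R (fib n.+2)%:R F1 F2' => c x y /lt0r_neq0 x0 /lt0r_neq0 y0.
  by field; apply/andP.
rewrite fib_defect normrM normrN normrM normrX normrN (gtr0_norm b0) -exprS.
rewrite gtr0_norm ?mulr_gt0 ?invr_gt0// mulrA ler_pM2r ?invr_gt0//.
rewrite ler_pdivrMr// (@le_trans _ _ (b ^+ n))//.
  by rewrite ler_wiXn2l ?(ltW b0) ?(ltW b1) ?(leqW (leqnSn n)).
by rewrite ler_peMr// exprn_ge0 ?ltW.
Qed.

Lemma recip_fib_sumS n : S n.+1 = S n + (fib n.+1)%:R^-1.
Proof. by rewrite /recip_fib_sum big_nat_recr. Qed.

Lemma recip_fib_sum_nondecreasing : nondecreasing_seq S.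
Proof.
by apply/nondecreasing_seqP => n; rewrite recip_fib_sumS lerDl invr_ge0.
Qed.

(** Adding the sum of the majorising geometric tail to [S] reverses its
    monotonicity, so that every value is an upper bound for the series. *)
Lemma recip_fib_sum_majorant_nonincreasing :
  nonincreasing_seq (fun n => S n + phi ^+ 3 * b ^+ n).
Proof.
apply/nonincreasing_seqP => n; rewrite recip_fib_sumS -addrA lerD2l.
have -> : phi ^+ 3 * b ^+ n = phi * b ^+ n + phi ^+ 3 * b ^+ n.+1.
  have p0 : phi != 0 by rewrite gt_eqF ?golden_ratio_gt0.
  have b2 : phi ^+ 3 * b ^+ 2 = phi by rewrite exprVn exprS mulfK// expf_neq0.
  rewrite -[X in _ = X * _ + _]b2 -mulrA -mulrDr inv_golden_ratio_sqr (exprS b).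
  by rewrite -mulrDl subrK mul1r.
by rewrite lerD2r inv_fib_le.
Qed.

Lemma recip_fib_sum_le n m : S m <= S n + phi ^+ 3 * b ^+ n.
Proof.
have [nm|/ltnW mn] := leqP n m; last first.
  rewrite (le_trans (recip_fib_sum_nondecreasing _ _ mn))// lerDl.
  by rewrite mulr_ge0 ?exprn_ge0 ?invr_ge0 ?(ltW golden_ratio_gt0).
apply: le_trans (recip_fib_sum_majorant_nonincreasing _ _ nm).
by rewrite lerDl mulr_ge0 ?exprn_ge0 ?invr_ge0 ?(ltW golden_ratio_gt0).
Qed.

Lemma is_cvg_recip_fib_sum : cvgn S.
Proof.
apply: nondecreasing_is_cvgn recip_fib_sum_nondecreasing _.
by exists (S 0 + phi ^+ 3 * b ^+ 0) => _ [m _ <-]; exact: recip_fib_sum_le.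
Qed.

Lemma recip_fib_tail_gt0 n : 0 < psi - S n.
Proof.
rewrite subr_gt0; apply: (@lt_le_trans _ _ (S n.+1)).
  by rewrite recip_fib_sumS ltrDl invr_gt0 ltr0n fibS_gt0.
exact: nondecreasing_cvgn_le recip_fib_sum_nondecreasing is_cvg_recip_fib_sum _.
Qed.

Lemma recip_fib_tail_le n : psi - S n <= phi ^+ 3 * b ^+ n.
Proof.
rewrite lerBlDl; apply: limr_le is_cvg_recip_fib_sum _.
by near=> m; exact: recip_fib_sum_le.
Unshelve. all: by end_near. Qed.

(** The finite form of [recip_fib_tail_ratio]: summing [inv_fib_ratio] over a
    block of terms, with the powers of [b] bounded by the largest one. *)
Lemma recip_fib_block_ratio n m : (n <= m)%N ->
  `|(S m.+1 - S n.+1) - b * (S m - S n)| <= b ^+ n * (S m - S n).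
Proof.
elim: m => [|m IH].
  by rewrite leqn0 => /eqP ->; rewrite !subrr !mulr0 subrr normr0.
rewrite leq_eqVlt ltnS => /predU1P[->|nm].
  by rewrite !subrr !mulr0 subrr normr0.
have -> : (S m.+2 - S n.+1) - b * (S m.+1 - S n)
    = ((S m.+1 - S n.+1) - b * (S m - S n))
      + ((fib m.+2)%:R^-1 - b * (fib m.+1)%:R^-1).
  by rewrite (recip_fib_sumS m.+1) (recip_fib_sumS m); ring.
have bmn : b ^+ m * (fib m.+1)%:R^-1 <= b ^+ n * (fib m.+1)%:R^-1.
  rewrite ler_wpM2r ?invr_ge0//.
  by rewrite ler_wiXn2l ?(ltW inv_golden_ratio_gt0) ?(ltW inv_golden_ratio_lt1).
have -> : b ^+ n * (S m.+1 - S n)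
    = b ^+ n * (S m - S n) + b ^+ n * (fib m.+1)%:R^-1.
  by rewrite recip_fib_sumS; ring.
apply: le_trans (ler_normD _ _) _.
exact: lerD (IH nm) (le_trans (inv_fib_ratio m) bmn).
Qed.

(** The error is relative to the tail, so division by the tail turns it into
    the vanishing error [b ^+ n] on the ratio. *)
Lemma recip_fib_tail_ratio n :
  `|(psi - S n.+1) - b * (psi - S n)| <= b ^+ n * (psi - S n).
Proof.
have cS : S m @[m --> \oo] --> psi by exact: is_cvg_recip_fib_sum.
have cS1 : S m.+1 @[m --> \oo] --> psi by have := cS; rewrite -cvg_shiftS.
have cB : S m - S n @[m --> \oo] --> psi - S n.
  exact: cvgB cS (cvg_cst _).
apply: (@ler_cvg_to _ \oo _ _
  (fun m => `|(S m.+1 - S n.+1) - b * (S m - S n)|)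
  (fun m => b ^+ n * (S m - S n))).
- exact: cvg_norm (cvgB (cvgB cS1 (cvg_cst _)) (cvgM (cvg_cst _) cB)).
- exact: cvgM (cvg_cst _) cB.
- by near=> m; apply: recip_fib_block_ratio; near: m; exact: nbhs_infty_ge.
Unshelve. all: by end_near. Qed.

End ReciprocalFibonacci.

Theorem corollary4p4 (R : realType) :
  [/\ recip_fib_sum R n @[n --> \oo] --> recip_fib_const R,
      (fun n : nat => recip_fib_const R - recip_fib_sum R n)
        =O_\oo (fun n : nat => (golden_ratio R) ^- n)
    & (recip_fib_const R - recip_fib_sum R n.+1)
        / (recip_fib_const R - recip_fib_sum R n) @[n --> \oo]
        --> (golden_ratio R)^-1].
Proof.
have b0 := inv_golden_ratio_gt0 R; have b1 := inv_golden_ratio_lt1 R.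
split; first exact: is_cvg_recip_fib_sum.
- apply/eqO_exP; exists (golden_ratio R ^+ 3).
    by rewrite exprn_gt0 ?golden_ratio_gt0.
  near=> n; rewrite (gtr0_norm (recip_fib_tail_gt0 R n)) -exprVn.
  by rewrite (gtr0_norm (exprn_gt0 n b0)) recip_fib_tail_le.
- apply/cvgrPdist_le => e e0.
  have bX : (golden_ratio R)^-1 ^+ n @[n --> \oo] --> (0 : R).
    by apply: cvg_expr; rewrite gtr0_norm.
  near=> n; have T0 := recip_fib_tail_gt0 R n.
  rewrite distrC -(ler_pM2r T0) -{2}(gtr0_norm T0) -normrM mulrBl divfK ?gt_eqF//.
  apply: le_trans (recip_fib_tail_ratio R n) _; rewrite ler_pM2r//.
  apply: le_trans (ler_norm _) _.
  near: n; exact: (cvgr0_norm_le _ bX).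
Unshelve. all: by end_near. Qed.
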